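(* Let $W=W(a,\lambda,k)=M_a(1)\otimes\Omega(\lambda,k)$ be the $M_a(1)$-module induced from the $A_0(M_a(1))=\mathbb{C}[x]$-module $U=\mathbb{C}[x]/((x-\lambda)^k)$, for fixed $k\in\mathbb{Z}_{>0}$ with $k\ge2$ and $\lambda,a\in\mathbb{C}$. Then the graded pseudo-trace of $W$ associated to the vacuum is given by $$\mathrm{pstr}_W(\mathbf 1,\tau)=q^{\frac12(\lambda-a)^2-1/24}\sum_{\ell\in\mathbb{Z}_{\ge0}}q^\ell\,\mathfrak p(\ell)\Bigg(\sum_{j=\lceil\frac{k-1}2\rceil}^{k-1}\frac1{j!}\binom{j}{k-j-1}2^{-k+j+1}(\lambda-a)^{2j-k+1}(\log q)^j\Bigg)$$ $$=q^{\frac12(\lambda-a)^2}\eta(q)^{-1}\Bigg(\sum_{j=\lceil\frac{k-1}2\rceil}^{k-1}\frac1{j!}\binom{j}{k-j-1}2^{-k+j+1}(\lambda-a)^{2j-k+1}(\log q)^j\Bigg),$$ where $\lceil\frac{k-1}2\rceil$ is the smallest integer greater than or equal to $\frac{k-1}2$, and formally $\log q=2\pi i\tau$.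
   Context: $\hat{\mathfrak h}$ is the Lie algebra with basis $\alpha_n$ ($n\in\mathbb{Z}$), $\mathbf{k}$, with $[\alpha_m,\alpha_n]=m\delta_{m+n,0}\mathbf{k}$, $\mathbf{k}$ central. $M_a(1)$ is the rank one Heisenberg vertex operator algebra: the $\hat{\mathfrak h}$-module generated by $\mathbf 1$ with $\alpha_n\mathbf 1=0$ ($n\ge0$), $\mathbf k=1$, with conformal vector $\omega^a=\frac12\alpha_{-1}^2\mathbf 1+a\alpha_{-2}\mathbf 1$ and central charge $c=1-12a^2$. Its level zero Zhu algebra is $\mathbb{C}[x]$, $x$ the class of $\alpha_{-1}\mathbf 1$, acting as $\alpha_0$. $W(a,\lambda,k)$ is the $\hat{\mathfrak h}$-module induced from $\Omega(\lambda,k)\cong\mathbb{C}[x]/((x-\lambda)^k)$ with $\alpha_n=0$ on $\Omega(\lambda,k)$ for $n>0$, $\mathbf k=1$, $\alpha_0=x$; Jordan basis $u_1,\dots,u_k$ with $\alpha_0u_1=\lambda u_1$, $\alpha_0u_j=\lambda u_j+u_{j-1}$. $L_0^a=\sum_{m>0}\alpha_{-m}\alpha_m+\frac12\alpha_0^2-a\alpha_0$; $W(\ell)$ (degree $\ell$, spanned by $\alpha_{-n_1}\cdots\alpha_{-n_j}u$, $\sum n_i=\ell$) is the generalized $L_0^a$-eigenspace of weight $\ell+\frac12\lambda^2-a\lambda$. $\mathfrak p(\ell)$ is the number of partitions of $\ell$, $\eta(q)=q^{1/24}\prod_{j\ge1}(1-q^j)$, $0^0=1$. Graded pseudo-trace: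 $W$ is strongly interlocked, i.e. its nontrivial proper submodules are finite in number, indecomposable, and form a chain $0=W^{(0)}\subset W^{(1)}\subset\cdots\subset W^{(k)}=W$ with $W^{(j+1)}/W^{(j)}\cong W^{(1)}=Soc(W)$ and $W/W^{(j)}\cong W^{(k-j)}$. In suitable (strongly interlocked) bases of the weight spaces $W_\mu$, weight-preserving operators $\sigma$ coming from the module structure (such as zero modes $o(v)=v_{\mathrm{wt}\,v-1}$ and powers of the nilpotent part $L_0^N$ of $L_0^a$) have $k\times k$ block upper triangular matrices with blocks of size $\dim Soc(W)_\mu$, all diagonal blocks equal to $\sigma|_{Soc(W)_\mu}$, first block row $(A,C_1,\dots,C_{k-2},B)$ and last block column $(B,C_{k-2},\dots,C_1,A)^T$; $\mathrm{pstr}(\sigma|_{W_\mu})=\mathrm{tr}(B)$, $B$ being the upper right corner block. The pseudo-trace is computed in the basis $\{b_1u_1,\dots,b_{\mathfrak p(\ell)}u_1,b_1u_2,\dots,b_{\mathfrak p(\ell)}u_k\}$ of $W(\ell)$, where $b_1,\dots,b_{\mathfrak p(\ell)}$ are the monomials $\alpha_{-n_1}\cdots\alpha_{-n_j}$ of degree $\ell$ and $u_1,\dots,u_k$ is the Jordan basis of $\Omega(\lambda,k)$ with $\alpha_0u_1=\lambda u_1$ and $\alpha_0u_j=\lambda u_j+u_{j-1}$ for $2\le j\le k$. Then $$\mathrm{pstr}_W(v,\tau)=\sum_\mu\sum_{j\ge0}\mathrm{pstr}\big(o(v)|_{W_\mu}\tfrac1{j!}(L_0^N)_\mu^j\big)(\log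 q)^jq^{\mu-c/24},\quad q=e^{2\pi i\tau},\ \log q=2\pi i\tau.$$ For irreducible $W$ (i.e. $k=1$) the graded pseudo-trace is defined to be zero. *)

(* Defs.v *)
From HB Require Import structures.
From mathcomp Require Import all_boot all_order all_algebra.
From mathcomp Require Import freeg.
From mathcomp Require Import all_classical all_reals all_analysis.
From mathcomp Require Import complex zify ring.

Set Implicit Arguments.
Unset Strict Implicit.
Unset Printing Implicit Defensive.

Import Order.TTheory GRing.Theory Num.Theory.
Import numFieldNormedType.Exports.

Local Open Scope ring_scope.
Local Open Scope complex_scope.
Local Open Scope classical_set_scope.

(* The topology of [R[i]] given by the complex modulus. *)
HB.instance Definition _ (R : rcfType) := NormedModule.copy R[i] R[i]^o.

(* A partition n_1 >= ... >= n_r > 0 indexes the monomial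
   alpha_{-n_1} ... alpha_{-n_r}. *)
Record intpart := IntPart {
  parts :> seq nat;
  partsP : sorted geq parts && (0%N \notin parts) }.

HB.instance Definition _ := [isSub for parts].
HB.instance Definition _ := [Choice of intpart by <:].

Definition empty_part : intpart := @IntPart [::] isT.

Lemma add_part_subproof n (p : intpart) :
  sorted geq (sort geq (n.+1 :: p)) && (0%N \notin sort geq (n.+1 :: p)).
Proof.
rewrite mem_sort in_cons /= sort_sorted; last by move=> x y; exact: leq_total.
by case/andP: (partsP p).
Qed.

Lemma rem_part_subproof n (p : intpart) :
  sorted geq (rem n p) && (0%N \notin rem n p).
Proof.
case/andP: (partsP p) => sp p0; apply/andP; split.
  apply: subseq_sorted (rem_subseq n p) sp.
  by move=> x y z; rewrite /geq /= => xy zx; exact: leq_trans zx xy.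
by apply: contra p0 => /mem_rem.
Qed.

(* Adds a part n.+1. *)
Definition add_part n (p : intpart) := IntPart (add_part_subproof n p).

(* Removes one part n (no effect if n is not a part). *)
Definition rem_part n (p : intpart) := IntPart (rem_part_subproof n p).

Definition partitions_of (l : nat) : seq intpart :=
  [seq p : intpart <- pmap insub
     [seq [seq val x | x <- val s] | s : l.-bseq 'I_l.+1] | sumn p == l].

Definition npart (l : nat) : nat := size (partitions_of l).

Lemma partitions_of_uniq l : uniq (partitions_of l).
Proof.
rewrite /partitions_of filter_uniq // pmap_sub_uniq // map_inj_uniq ?enum_uniq //.
by move=> s t /(inj_map val_inj) /val_inj.
Qed.

Lemma mem_partitions_of l (p : intpart) :
  (p \in partitions_of l) = (sumn p == l).
Proof.
rewrite mem_filter; case: eqP => //= <-.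
have le_sumn (s : seq nat) x : x \in s -> (x <= sumn s)%N.
  elim: s => //= y s IH; rewrite in_cons => /orP[/eqP->|/IH xs].
    by rewrite leq_addr.
  exact: leq_trans xs (leq_addl _ _).
have sz : (size [seq inord x : 'I_(sumn p).+1 | x <- p] <= sumn p)%N.
  rewrite size_map; case/andP: (partsP p) => _.
  elim: (parts p) => //= x s IH; rewrite in_cons negb_or => /andP[x0 /IH].
  by move=> les; rewrite -add1n leq_add // lt0n eq_sym.
rewrite mem_pmap_sub /=; apply/mapP; exists (Bseq sz); first by rewrite mem_enum.
rewrite /= -map_comp -[LHS]map_id; apply/eq_in_map => x xp /=.
by rewrite inordK // ltnS le_sumn.
Qed.

Section Module.
Variables (R : realType) (k : nat) (lam a : R[i]).

(* The basis of W(a, lam, k) = M_a(1) (x) Omega(lam, k): the pair (p, j) stands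
   for b_p u_{j+1}, with b_p the monomial of p and u_1, ..., u_k the Jordan
   basis of Omega(lam, k). *)
Definition state : Type := (intpart * 'I_k)%type.
HB.instance Definition _ := Choice.on state.

Definition heis_module := {freeg state / R[i]}.
HB.instance Definition _ := GRing.Lmodule.on heis_module.

Definition ket (b : state) : heis_module := << b >>.

Definition degree (b : state) : nat := sumn b.1.

Definition extend (f : state -> heis_module) : heis_module -> heis_module :=
  fglift f.

Definition ord_prev (j : 'I_k) : 'I_k :=
  Ordinal (leq_ltn_trans (leq_pred j) (ltn_ord j)).

(* The mode alpha_n in the induced module:
   - alpha_{-n}, n > 0, multiplies by the variable alpha_{-n};
   - alpha_0 acts by u_1 |-> lam u_1 and u_j |-> lam u_j + u_{j-1};
   - alpha_n, n > 0, is n d/d(alpha_{-n}). *)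
Definition alpha_basis (n : int) (b : state) : heis_module :=
  match n with
  | Negz m => ket (add_part m b.1, b.2)
  | Posz 0 =>
      lam *: ket b + (if b.2 == 0%N :> nat then 0 else ket (b.1, ord_prev b.2))
  | Posz m => (m * count_mem m b.1)%:R *: ket (rem_part m b.1, b.2)
  end.

Definition alpha (n : int) : heis_module -> heis_module :=
  extend (alpha_basis n).

(* L_0^a; on a basis vector b, alpha_m b = 0 as soon as m > degree b. *)
Definition L0 : heis_module -> heis_module :=
  extend (fun b =>
    \sum_(1 <= m < (degree b).+1) alpha (- m%:Z) (alpha m%:Z (ket b))
    + 2^-1 *: alpha 0 (alpha 0 (ket b)) - a *: alpha 0 (ket b)).

(* The generalized L_0^a-eigenvalue on W(l). *)
Definition weight (l : nat) : R[i] := l%:R + 2^-1 * lam ^+ 2 - a * lam.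

(* L_0^a = L_0^S + L_0^N, where L_0^S acts on W(l) as the scalar [weight l];
   see [L0N_nilpotent] below. *)
Definition L0S : heis_module -> heis_module :=
  extend (fun b => weight (degree b) *: ket b).

Definition L0N (w : heis_module) : heis_module := L0 w - L0S w.

(* :alpha_{m_1} ... alpha_{m_r}: w, creation modes (m < 0) to the left. *)
Definition normal_ordered (ms : seq int) (w : heis_module) : heis_module :=
  foldr alpha w ([seq m <- ms | m < 0] ++ [seq m <- ms | 0 <= m]).

Definition gbinom (x : R[i]) (n : nat) : R[i] :=
  (\prod_(i < n) (x - i%:R)) / n`!%:R.

(* The zero mode o(v) for v = alpha_{-n_1} ... alpha_{-n_r} 1, n = (n_1..n_r).
   Since Y(v, x) = :prod_i 1/(n_i - 1)! (d/dx)^(n_i - 1) alpha(x): with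
   alpha(x) = sum_m alpha_m x^(-m-1), it is the sum over m_1 + ... + m_r = 0 of
   prod_i binom(-m_i - 1, n_i - 1) :alpha_{m_1} ... alpha_{m_r}:.
   On a vector of degree d only the terms with all |m_i| <= d survive; the
   index t_i ranges over 0..2d and m_i = t_i - d. *)
Definition zero_mode_basis (n : intpart) : heis_module -> heis_module :=
  extend (fun b =>
    \sum_(t : (size n).-tuple 'I_(degree b).*2.+1)
      let ms := [seq (val x)%:Z - (degree b)%:Z | x <- val t] in
      if \sum_(m <- ms) m == 0 then
        (\prod_(mn <- zip ms n) gbinom (- mn.1%:~R - 1) mn.2.-1)
          *: normal_ordered ms (ket b)
      else 0).

End Module.

(* The underlying space of M_a(1), with basis the alpha_{-n_1}...alpha_{-n_r} 1. *)
Definition heis_voa (R : realType) := {freeg intpart / R[i]}.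

Definition vacuum (R : realType) : heis_voa R := << empty_part >>.

Definition zero_mode (R : realType) (k : nat) (lam : R[i]) (v : heis_voa R)
    (w : heis_module R k) : heis_module R k :=
  fglift (fun n => zero_mode_basis lam n w) v.

Lemma intpart_eqP (p q : intpart) :
  (forall x, count_mem x p = count_mem x q) -> p = q.
Proof.
move=> pq; apply: val_inj; apply: (@sorted_eq _ geq).
- by move=> x y z; rewrite /geq /= => xy zx; exact: leq_trans zx xy.
- by move=> x y; rewrite /geq /= => yx; apply/eqP; rewrite eqn_leq andbC.
- by case/andP: (partsP p).
- by case/andP: (partsP q).
- by apply/allP => x _ /=; rewrite pq.
Qed.

Lemma count_add_part n (p : intpart) x :
  count_mem x (add_part n p) = ((n.+1 == x) + count_mem x p)%N.
Proof. by rewrite /= count_sort. Qed.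

Lemma count_rem_part n (p : intpart) x :
  count_mem x (rem_part n p) = (count_mem x p - (n == x))%N.
Proof.
rewrite count_rem /=; case: (boolP (n \in val p)) => np //=.
rewrite subn0; case: eqP => [<-|_]; last by rewrite subn0.
by rewrite (count_memPn np).
Qed.

Lemma extend_ket (R : realType) k (f : state k -> heis_module R k) b :
  extend f (ket R b) = f b.
Proof. by rewrite /extend /ket liftU scale1r. Qed.

Lemma extend_is_linear (R : realType) k (f : state k -> heis_module R k) :
  linear (extend f).
Proof.
move=> c u v; rewrite /extend.
have Bf x y : fglift f (x - y) = fglift f x - fglift f y := lift_is_additive f x y.
have Z0 : fglift f 0 = 0 by rewrite -[X in fglift f X](subrr 0) Bf subrr.
have A x y : fglift f (x + y) = fglift f x + fglift f y.
  by rewrite -[y in LHS]opprK Bf -[- y]sub0r Bf Z0 sub0r opprK.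
rewrite A; congr (_ + _).
rewrite -[u in LHS]freeg_sumE -[u in RHS]freeg_sumE.
elim: (dom u) => [|x s IH]; first by rewrite !big_nil scaler0 Z0 scaler0.
rewrite !big_cons scalerDr !A IH scalerDr; congr (_ + _).
have -> : c *: << coeff x u *g x >> = << c * coeff x u *g x >> :> {freeg _ / R[i]}.
  by apply/eqP/freeg_eqP => y; rewrite coeffZ !coeffU mulrA.
by rewrite !liftU scalerA.
Qed.

HB.instance Definition _ (R : realType) k (f : state k -> heis_module R k) :=
  GRing.isLinear.Build _ _ _ _ (extend f) (extend_is_linear f).
HB.instance Definition _ (R : realType) k lam n :=
  GRing.Linear.copy (@alpha R k lam n) (extend (alpha_basis lam n)).

Lemma alpha_ket (R : realType) k (lam : R[i]) n (b : state k) :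
  alpha lam n (ket R b) = alpha_basis lam n b.
Proof. exact: extend_ket. Qed.

Lemma heis_dec (R : realType) k (w : heis_module R k) :
  w = \sum_(x <- dom w) coeff x w *: ket R x.
Proof.
rewrite -[LHS]freeg_sumE; apply: eq_bigr => x _.
by apply/eqP/freeg_eqP => y; rewrite coeffZ !coeffU mul1r.
Qed.

Lemma alpha_comm (R : realType) k (lam : R[i]) (m n : int) (w : heis_module R k) :
  alpha lam m (alpha lam n w) - alpha lam n (alpha lam m w)
  = (if m + n == 0 then m%:~R else 0) *: w.
Proof.
set c := if _ then _ else _.
suff H (b : state k) : alpha lam m (alpha lam n (ket R b)) =
    alpha lam n (alpha lam m (ket R b)) + c *: ket R b.
    rewrite (heis_dec w); elim: (dom w) => [|x s IH].
    by rewrite big_nil !linear0 addr0.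
  rewrite big_cons [in RHS]linearD !(raddfD (alpha lam _)) /= opprD addrACA -IH; congr (_ + _).
  by rewrite !(linearZ_LR (alpha lam _)) /= H scalerDr addrAC subrr add0r !scalerA mulrC.
rewrite /c {c}; case: b => p j.
wlog: m n / (m <= n)%R.
  move=> W; case/orP: (le_total m n) => [|nm]; first exact: W.
  rewrite (W n m nm) -addrA -scalerDl (addrC n).
  case: eqP => [/eqP|_]; last by rewrite addr0 scale0r addr0.
  by rewrite addr_eq0 => /eqP ->; rewrite -intrD ?addNr ?subrr scale0r addr0.
case: m n => [[|m]|m] [[|n]|n] //= mn; rewrite ?add0r ?addr0 ?(scale0r, addr0) //.
- rewrite !alpha_ket /= linearZ /= !alpha_ket /= !linearD /= !linearZ /= alpha_ket /=.
  by congr (_ + _); case: eqP => _; rewrite ?linear0 ?scaler0 // alpha_ket.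
- rewrite !alpha_ket /= !linearZ /= !alpha_ket /= !scalerA -!natrM.
  have E : rem_part m.+1 (rem_part n.+1 p) = rem_part n.+1 (rem_part m.+1 p).
    by apply: intpart_eqP => x; rewrite !count_rem_part -!subnDA addnC.
  congr (_%:R *: ket R (_, _)); last by [].
  by have := count_rem_part; rewrite /= => H; rewrite !H; case: eqVneq => [->|]; rewrite ?eqxx //; lia.
- rewrite !alpha_ket /= !linearD /= !linearZ /= !alpha_ket /=; congr (_ + _).
  by case: eqP => _; rewrite ?linear0 // alpha_ket.
- rewrite !alpha_ket /= !linearZ /= !alpha_ket /=.
  have -> : (Negz m + n.+1 == 0) = (m == n) by rewrite NegzE; lia.
  have := count_add_part m p n.+1 => /= ->.
  rewrite eqSS; case: eqVneq => [<-|mn'].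
    rewrite NegzE rmorphN /= scaleNr.
    have -> : rem_part m.+1 (add_part m p) = p.
      by apply: intpart_eqP => x; rewrite count_rem_part count_add_part addKn.
    rewrite mulnDr muln1 natrD scalerDl -pmulrn addrAC subrr add0r.
    have [z|nz] := posnP (count_mem m.+1 p); first by rewrite z muln0 !scale0r.
    congr (_ *: ket R (_, _)); apply: intpart_eqP => x.
    by rewrite count_add_part count_rem_part subnKC //; case: eqP => // <-.
  rewrite scale0r addr0 add0n.
  have [z|nz] := posnP (count_mem n.+1 p); first by rewrite z muln0 !scale0r.
  congr (_ *: ket R (_, _)); apply: intpart_eqP => x.
  rewrite count_add_part !count_rem_part count_add_part.
  by case: eqP => [<-|]; case: eqP => // e; lia.
- rewrite !alpha_ket /=; congr (ket R (_, _)).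
  by apply: intpart_eqP => x; rewrite !count_add_part addnCA.
Qed.

Lemma alpha_pos_lowest (R : realType) k (lam : R[i]) n (j : 'I_k) :
  alpha lam n.+1%:Z (ket R (empty_part, j)) = 0.
Proof. by rewrite alpha_ket /= muln0 scale0r. Qed.

Lemma ket_monomial (R : realType) k (lam : R[i]) (p : intpart) (j : 'I_k) :
  ket R (p, j)
  = foldr (fun n : nat => alpha lam (- n%:Z)) (ket R (empty_part, j)) p.
Proof.
case: p => s sP; elim: s sP => [|n s IH] sP.
  by congr (ket R (_, _)); apply: val_inj.
have ss : sorted geq s && (0%N \notin s).
  case/andP: (sP) => /path_sorted -> /=; by rewrite in_cons negb_or => /andP[].
rewrite /= -(IH ss); case: n sP => [|n] sP; first by case/andP: (sP); rewrite in_cons eqxx.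
rewrite -NegzE alpha_ket /=; congr (ket R (_, _)); apply: intpart_eqP => x.
by rewrite count_add_part.
Qed.

Lemma zero_mode_vacuum (R : realType) k (lam : R[i]) (w : heis_module R k) :
  zero_mode lam (vacuum R) w = w.
Proof.
rewrite /zero_mode /vacuum liftU scale1r [RHS]heis_dec [w in LHS]heis_dec.
rewrite /zero_mode_basis linear_sum; apply: eq_bigr => b _ /=.
rewrite linearZ /= extend_ket; congr (_ *: _).
rewrite (big_pred1 [tuple]) => [|t]; last by rewrite /= [t]tuple0; apply/esym/eqP.
by rewrite /= !big_nil eqxx scale1r.
Qed.

Lemma sum_count_mem N (s : seq nat) :
  all (fun x => x <= N)%N s -> 0%N \notin s ->
  (\sum_(1 <= m < N.+1) m * count_mem m s)%N = sumn s.
Proof.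
elim: s => [_ _|x s IH /= /andP[xN sN]].
  by rewrite big1 // => m; rewrite muln0.
rewrite in_cons negb_or => /andP[x0 s0].
under eq_bigr do rewrite mulnDr.
rewrite big_split /= IH //; congr (_ + _)%N.
rewrite (bigD1_seq x) ?iota_uniq ?mem_index_iota //=; last first.
  by rewrite ltnS xN lt0n eq_sym x0.
by rewrite eqxx muln1 big1 ?addn0 // => m /negPf; rewrite eq_sym => ->; rewrite muln0.
Qed.

Lemma degree_op (R : realType) k (lam : R[i]) (b : state k) :
  \sum_(1 <= m < (degree b).+1) alpha lam (- m%:Z) (alpha lam m%:Z (ket R b))
  = (degree b)%:R *: ket R b.
Proof.
case: b => p j; rewrite /degree /=.
under eq_big_nat => m /andP[m0 _].
  have -> : alpha lam (- m%:Z) (alpha lam m%:Z (ket R (p, j)))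
      = (m * count_mem m p)%:R *: ket R (p, j).
    case: m m0 => // m _; rewrite -NegzE !alpha_ket /= linearZ /= alpha_ket /=.
    have [z|nz] := posnP (count_mem m.+1 p); first by rewrite z muln0 !scale0r.
    congr (_ *: ket R (_, _)); apply: intpart_eqP => x.
    by rewrite count_add_part count_rem_part subnKC //; case: eqP => // <-.
  over.
rewrite -scaler_suml -natr_sum; congr (_%:R *: _).
case/andP: (partsP p) => _; apply: sum_count_mem.
apply/allP => x; elim: (parts p) => //= y s IH; rewrite in_cons.
by case/orP => [/eqP->|/IH xs]; rewrite ?leq_addr // (leq_trans xs) ?leq_addl.
Qed.

Lemma L0N_ket (R : realType) k (lam a : R[i]) (b : state k) :
  L0N lam a (ket R b)
  = 2^-1 *: (alpha lam 0 (alpha lam 0 (ket R b)) - lam ^+ 2 *: ket R b)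
    - a *: (alpha lam 0 (ket R b) - lam *: ket R b).
Proof.
rewrite /L0N /L0 /L0S !extend_ket degree_op /weight.
by apply/eqP/freeg_eqP => s; rewrite !(coeffD, coeffN, coeffZ); ring.
Qed.

Lemma L0N_is_linear (R : realType) k (lam a : R[i]) : linear (@L0N R k lam a).
Proof.
move=> c u v; rewrite /L0N /L0 /L0S !(linearP (extend _)).
by rewrite scalerBr opprD addrACA.
Qed.
HB.instance Definition _ (R : realType) k lam a :=
  GRing.isLinear.Build _ _ _ _ (@L0N R k lam a) (@L0N_is_linear R k lam a).

Lemma L0N_nilpotent (R : realType) k (lam a : R[i]) (w : heis_module R k) :
  iter k (L0N lam a) w = 0.
Proof.
have I0 n : iter n (L0N lam a) (0 : heis_module R k) = 0.
  by elim: n => //= n ->; rewrite linear0.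
have IL n c (u v : heis_module R k) : iter n (L0N lam a) (c *: u + v)
    = c *: iter n (L0N lam a) u + iter n (L0N lam a) v.
  by elim: n => //= n ->; rewrite linearP.
have K n p (j : 'I_k) : (j < n)%N -> iter n (L0N lam a) (ket R (p, j)) = 0.
  elim/ltn_ind: n j => -[//|n] IH j jn; rewrite iterSr L0N_ket !alpha_ket /=.
  set K1 := if _ then _ else _.
  have K1n : iter n (L0N lam a) K1 = 0.
    rewrite /K1; case: eqP => [_|j0]; first exact: I0.
    by apply: IH => //=; lia.
  set X := alpha _ _ _; set z := ket _ _.
  have -> : X = lam *: (lam *: z + K1) + alpha lam 0 K1 by
    rewrite /X linearD linearZ /= alpha_ket.
  set Y := alpha _ _ _.
  have -> : 2^-1 *: (lam *: (lam *: z + K1) + Y - lam ^+ 2 *: z)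
       - a *: (lam *: z + K1 - lam *: z)
     = 2^-1 *: Y + ((2^-1 * lam - a) *: K1 + 0).
    by apply/eqP/freeg_eqP => s; rewrite !(coeffD, coeffN, coeffZ, coeff0); ring.
  rewrite !IL K1n scaler0 I0 !addr0.
  rewrite /Y /K1; case: eqP => [_|j0]; first by rewrite linear0 I0 scaler0.
  rewrite alpha_ket /= IL.
  rewrite (IH n) //=; last by lia.
  case: eqP => [_|j1]; first by rewrite !I0 !(scaler0, addr0).
  by rewrite IH ?(scaler0,addr0) //=; lia.
rewrite (heis_dec w); elim: (dom w) => [|[p j] s IH]; first by rewrite big_nil I0.
by rewrite big_cons IL IH K ?scaler0 ?addr0.
Qed.

Lemma sum_1tuple (R : zmodType) (T : finType) (F : 1.-tuple T -> R) :
  \sum_t F t = \sum_x F [tuple x].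
Proof.
rewrite (reindex (fun x => [tuple x])) //; exists (fun t : 1.-tuple T => thead t) => t _ //.
by apply/eq_from_tnth => i; rewrite (ord1 i) (tnth_nth (thead t)) /= /thead; congr tnth; apply: val_inj.
Qed.
Lemma sum_2tuple (R : zmodType) (T : finType) (F : 2.-tuple T -> R) :
  \sum_t F t = \sum_x \sum_y F [tuple x; y].
Proof.
rewrite pair_bigA /= (reindex (fun x => [tuple x.1; x.2])) //.
exists (fun t : 2.-tuple T => (tnth t ord0, tnth t (fintype.lift ord0 ord0))) => [[x y] _|t _] //=.
by apply/eq_from_tnth => -[[|[|//]] i]; rewrite (tnth_nth (tnth t ord0)) /=; congr tnth; apply: val_inj.
Qed.
Lemma reidx (V : zmodType) d (F : nat -> V) : \sum_(d.+1 <= m < d.*2.+1) F m = \sum_(1 <= m < d.+1) F (m + d)%N.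
Proof. by rewrite -addnn -[d.+1]add1n big_addn -add1n; congr bigop; congr index_iota; lia. Qed.

Lemma extend_comb (R : realType) k (g1 g2 g3 : state k -> heis_module R k) c1 c2 w :
  (forall b, c1 *: g1 b + c2 *: g2 b = g3 b) ->
  c1 *: extend g1 w + c2 *: extend g2 w = extend g3 w.
Proof.
move=> H; rewrite (heis_dec w); elim: (dom w) => [|b s IH].
  by rewrite big_nil !linear0 addr0.
rewrite big_cons !(linearP (extend _)) /= -IH !extend_ket -H.
by apply/eqP/freeg_eqP => t; rewrite !(coeffD, coeffN, coeffZ, coeffU); ring.
Qed.

Definition conformal_part2 : intpart := @IntPart [:: 2] isT.
Definition conformal_part11 : intpart := @IntPart [:: 1; 1] isT.

(* L_0^a is the zero mode of omega^a = 1/2 alpha_{-1}^2 1 + a alpha_{-2} 1. *)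
Lemma L0_conformal (R : realType) k (lam a : R[i]) (w : heis_module R k) :
  zero_mode lam (2^-1 *: << conformal_part11 >> + a *: << conformal_part2 >>
                  : heis_voa R) w = L0 lam a w.
Proof.
have Bf (f : intpart -> heis_module R k) x y : fglift f (x - y) = fglift f x - fglift f y := lift_is_additive f x y.
have -> : zero_mode lam (2^-1 *: << conformal_part11 >> + a *: << conformal_part2 >>
                  : heis_voa R) w = 2^-1 *: zero_mode_basis lam conformal_part11 w + a *: zero_mode_basis lam conformal_part2 w.
  rewrite /zero_mode.
  have -> : (2^-1 *: << conformal_part11 >> + a *: << conformal_part2 >> : heis_voa R)
     = << 2^-1 *g conformal_part11 >> - << - a *g conformal_part2 >>.
    by apply/eqP/freeg_eqP => s; rewrite !(coeffD, coeffN, coeffZ, coeffU); ring.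
  by rewrite Bf !liftU scaleNr opprK.
rewrite /zero_mode_basis /L0.
apply: extend_comb => b /=.
set d := degree b; set G := ket R b.
have S2 : \sum_(1 <= m < d.+1) alpha lam (- m%:Z) (alpha lam m%:Z G) =
   \sum_(0 <= m < d) alpha lam (m%:Z - d%:Z) (alpha lam (d%:Z - m%:Z) G).
  rewrite big_add1 big_nat_rev /=; apply: eq_big_nat => m md.
  by congr (alpha lam _ (alpha lam _ G)); lia.
have S3 : \sum_(1 <= m < d.+1) alpha lam (- m%:Z) (alpha lam m%:Z G) =
   \sum_(d.+1 <= m < d.*2.+1) alpha lam (d%:Z - m%:Z) (alpha lam (m%:Z - d%:Z) G).
  rewrite reidx; apply: eq_bigr => m _.
  by congr (alpha lam _ (alpha lam _ G)); lia.
rewrite sum_1tuple sum_2tuple.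
have dP : (d < d.*2.+1)%N by lia.
set Q1 := (X in _ *: X + _ = _); set Q2 := (X in _ + a *: X = _).
have -> : Q2 = - alpha lam 0 G.
  rewrite /Q2 (bigD1 (Ordinal dP)) //= [X in _ + X = _]big1 ?addr0; last first.
    move=> x xd; rewrite big_seq1; case: eqP => // e; case/eqP: xd; apply: val_inj => /=; lia.
  rewrite /= !big_seq1 subrr eqxx /gbinom big_ord1 /= /normal_ordered /=. 
  by rewrite !subr0 oppr0 sub0r divr1 scaleN1r.
have T x : \sum_(y < d.*2.+1) (if \sum_(m <- [:: x%:Z - d%:Z; (val y)%:Z - d%:Z]) m == 0 then
    \prod_(mn <- [:: (x%:Z - d%:Z, 1%N); ((val y)%:Z - d%:Z, 1%N)]) gbinom (- mn.1%:~R - 1) mn.2.-1 *: normal_ordered lam [:: x%:Z - d%:Z; (val y)%:Z - d%:Z] G else 0)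
   = if (x < d.*2.+1)%N then normal_ordered lam [:: x%:Z - d%:Z; d%:Z - x%:Z] G else 0.
  case: ifP => xd; last first.
    by apply: big1 => y _; rewrite !big_cons big_nil; case: eqP => // e; have := ltn_ord y; lia.
  have xd' : (d.*2 - x < d.*2.+1)%N by lia.
  rewrite (bigD1 (Ordinal xd')) //= [X in _ + X = _]big1 ?addr0; last first.
    move=> y yx; rewrite !big_cons big_nil; case: eqP => // e; case/eqP: yx; apply: val_inj => /=; lia.
  have -> : (d.*2 - x)%N%:Z - d%:Z = d%:Z - x%:Z by lia.
  rewrite !big_cons !big_nil; case: eqP => [_|]; last by lia.
  by rewrite /= /gbinom !big_ord0 fact0 !divr1 !mulr1 scale1r.
have -> : Q1 = \sum_(0 <= x < d.*2.+1) normal_ordered lam [:: x%:Z - d%:Z; d%:Z - x%:Z] G.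
  rewrite big_mkord; apply: eq_bigr => x _; have := T x; rewrite ltn_ord => <-.
  by apply: eq_bigr.
rewrite (@big_cat_nat _ _ _ d) ?leq0n //=; last by lia.
rewrite (@big_ltn _ _ _ d) //=.
rewrite subrr /normal_ordered /=.
set A := \sum_(0 <= i < d) _; set B := \sum_(d.+1 <= i < _) _.
have -> : A = \sum_(1 <= m < d.+1) alpha lam (- m%:Z) (alpha lam m%:Z G).
  rewrite S2 /A; apply: eq_big_nat => m /andP[_ md].
  have -> : (m%:Z - d%:Z < 0) = true by lia.
  have -> : (d%:Z - m%:Z < 0) = false by lia.
  have -> : (0 <= m%:Z - d%:Z) = false by lia.
  have -> : (0 <= d%:Z - m%:Z) = true by lia.
  by [].
have -> : B = \sum_(1 <= m < d.+1) alpha lam (- m%:Z) (alpha lam m%:Z G).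
  rewrite S3 /B; apply: eq_big_nat => m /andP[md _].
  have -> : (m%:Z - d%:Z < 0) = false by lia.
  have -> : (d%:Z - m%:Z < 0) = true by lia.
  have -> : (0 <= m%:Z - d%:Z) = true by lia.
  have -> : (0 <= d%:Z - m%:Z) = false by lia.
  by [].
by apply/eqP/freeg_eqP => t; rewrite !(coeffD, coeffN, coeffZ, coeffU); field.
Qed.

(* The (r, s) block, of size dim Soc(W)_mu = npart l, of the matrix of sigma on
   W(l) in the basis (b_1 u_1, ..., b_{p(l)} u_1, b_1 u_2, ..., b_{p(l)} u_k);
   columns are the coordinates of the images of the basis vectors. *)
Definition block (R : realType) (k l : nat)
    (sigma : heis_module R k -> heis_module R k) (r s : 'I_k) :
    'M[R[i]]_(npart l) :=
  let b := tnth (in_tuple (partitions_of l)) in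
  \matrix_(i, i') coeff (b i, r) (sigma (ket R (b i', s))).

(* The pseudo-trace on W(l): the trace of the upper right corner block. *)
Definition pstr (R : realType) (k l : nat)
    (sigma : heis_module R k.+1 -> heis_module R k.+1) : R[i] :=
  \tr (block l sigma ord0 ord_max).

Section PseudoTrace.
Variables (R : realType).

Definition cexp (z : R[i]) : R[i] :=
  (expR (complex.Re z))%:C
  * (cos (complex.Im z) +i* sin (complex.Im z))%C.

Definition logq (tau : R[i]) : R[i] := 2 * (pi : R)%:C * 'i%C * tau.

(* q^s = e^{2 pi i tau s}; in particular q = [qpow tau 1]. *)
Definition qpow (tau s : R[i]) : R[i] := cexp (s * logq tau).

Definition dedekind_eta (tau : R[i]) : R[i] :=
  qpow tau (24^-1)
  * limn (fun N => \prod_(1 <= j < N) (1 - qpow tau 1 ^+ j)).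

Variables (a lam : R[i]).

Definition central_charge : R[i] := 1 - 12 * a ^+ 2.

(* The j-th summand of the inner sum of pstr_W(v, tau) at mu = weight lam a l.
   It is zero by convention when k <= 1 (the irreducible case). *)
Definition graded_pstr_summand (k : nat) (v : heis_voa R) (tau : R[i])
    (l j : nat) : R[i] :=
  if k is k'.+2 then
    pstr (k := k'.+1) l (fun w =>
        zero_mode lam v ((j`!%:R)^-1 *: iter j (L0N lam a) w))
    * logq tau ^+ j
  else 0.

Definition graded_pstr_coef (k : nat) (v : heis_voa R) (tau : R[i]) (l : nat) :
    R[i] :=
  limn (series (graded_pstr_summand k v tau l)).

(* The weights mu of W(a, lam, k) are the [weight lam a l], l in nat. *)
Definition graded_pstr_term (k : nat) (v : heis_voa R) (tau : R[i]) (l : nat) :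
    R[i] :=
  graded_pstr_coef k v tau l * qpow tau (weight lam a l - central_charge / 24).

Definition graded_pstr (k : nat) (v : heis_voa R) (tau : R[i]) : R[i] :=
  limn (series (graded_pstr_term k v tau)).

End PseudoTrace.

(* Main.v *)
From HB Require Import structures.
Require Import Defs.
From mathcomp Require Import all_boot all_order all_algebra.
From mathcomp Require Import freeg.
From mathcomp Require Import all_classical all_reals all_analysis.
From mathcomp Require Import complex zify ring lra.

(** The vacuum acts as the identity, so only the powers of the nilpotent part of
    L_0 contribute.  Put N = alpha_0 - lam, which lowers the Jordan index by one
    and fixes the monomial.  Substituting alpha_0 = lam + N in L_0 gives
    L_0^N = c N + N^2 / 2 with c = lam - a, hence
    (L_0^N)^j = sum_i binom(j, i) c^(j-i) 2^(-i) N^(j+i).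
    The upper right corner block of N^m is the identity if m = k - 1 and zero
    otherwise, so the pseudo-trace on W(l) is p(l) times the coefficient of index
    i = k - 1 - j, which vanishes unless (k - 1)/2 <= j < k
    ([graded_pstr_summand_vacuum]).  The sum over j is thus finite and equals
    p(l) P, with P independent of l.  Since
    weight l - c_a / 24 = l + (lam - a)^2 / 2 - 1/24, with c_a the central
    charge, what remains is Euler's identity sum_l p(l) q^l = prod_j (1 - q^j)^(-1)
    for |q| < 1, including the convergence of both sides to non-zero limits
    ([partition_generating_function]).

    For Euler's identity, let p_N(l) count the partitions of l into parts smaller
    than N.  Removing one part N yields p_(N+1)(l) = p_N(l) + p_(N+1)(l - N)
    ([npart_ltS]).  For real 0 <= r < 1 the recurrence bounds all partial sums of
    sum_l p_N(l) r^l by a constant independent of N, so the series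
    sum_l p(l) r^l converges; by comparison sum_l p(l) q^l converges, say to S,
    and so does each sum_l p_N(l) q^l, whose limit must be the inverse of
    E_N = prod_(1 <= j < N) (1 - q^j) by the same recurrence.  As
    p_N(l) = p(l) for l < N, the difference between 1 / E_N and S is at most a
    tail of sum_l p(l) r^l, so 1 / E_N tends to S.  Finally |E_N| is bounded,
    which excludes S = 0; therefore E_N tends to 1 / S, and the convergence of
    Euler's product comes as a by-product. *)

Import Order.TTheory GRing.Theory Num.Theory numFieldNormedType.Exports.
Set Implicit Arguments.
Unset Strict Implicit.
Unset Printing Implicit Defensive.
Local Open Scope ring_scope.
Local Open Scope complex_scope.
Local Open Scope classical_set_scope.

(** * Powers of the nilpotent part of L_0 *)

Section ShiftPowers.
Variables (R : realType) (k : nat) (lam a : R[i]).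
Local Notation W := (heis_module R k.+1).

Definition shift (w : W) : W := alpha lam 0 w - lam *: w.

Lemma shift_is_linear : linear shift.
Proof.
move=> c u v; rewrite /shift linearP scalerDr opprD addrACA scalerBr.
by rewrite !scalerA mulrC.
Qed.
HB.instance Definition _ := GRing.isLinear.Build _ _ _ _ shift shift_is_linear.

(** With alpha_0 = x: 1/2 (x^2 - lam^2) - a (x - lam) equals
    (lam - a) N + N^2 / 2 for N = x - lam. *)
Lemma L0N_shift (w : W) :
  L0N lam a w = (lam - a) *: shift w + 2^-1 *: shift (shift w).
Proof.
rewrite (heis_dec w); elim: (dom w) => [|b s IH].
  by rewrite big_nil !linear0 addr0.
rewrite big_cons (linearP (L0N lam a)) /= IH !(linearP shift) /=.
suff -> : L0N lam a (ket R b) =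
    (lam - a) *: shift (ket R b) + 2^-1 *: shift (shift (ket R b)).
  by rewrite !scalerDr !scalerA ![_ * coeff b w]mulrC addrACA.
rewrite L0N_ket /shift !(linearB (alpha lam 0)) (linearZ_LR (alpha lam 0)) /=.
by apply/eqP/freeg_eqP => t; rewrite !(coeffD, coeffN, coeffZ); field.
Qed.

Lemma iter_shift_ket m (p : intpart) (s : 'I_k.+1) :
  iter m shift (ket R (p, s)) =
  if (m <= s)%N then ket R (p, inord (s - m)) else 0.
Proof.
elim: m => [|m IH] /=; first by rewrite subn0 inord_val.
rewrite IH; case: (ltnP m s) => ms; last first.
  have [->|nms] := eqVneq m s; last by rewrite ifF ?linear0 //; lia.
  rewrite leqnn subnn /shift alpha_ket /= inordK // eqxx addr0.
  by rewrite subrr.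
rewrite ltnW //; rewrite /shift alpha_ket /= inordK; last by have := ltn_ord s; lia.
rewrite ifF; last by lia.
rewrite addrAC subrr add0r; congr (ket R (_, _)); apply: val_inj => /=.
by rewrite !inordK; have := ltn_ord s; lia.
Qed.

(** The binomial expansion of (c N + N^2 / 2)^j, with c = lam - a; the operators
    do not form a commutative ring, so it is proved by Pascal's rule. *)
Lemma iter_L0N j (w : W) :
  iter j (L0N lam a) w =
  \sum_(i < j.+1) ('C(j, i)%:R * (lam - a) ^+ (j - i) * 2^-1 ^+ i)
                   *: iter (j + i) shift w.
Proof.
elim: j => [|j IH].
  by rewrite big_ord1 /= expr0 !mulr1 scale1r.
rewrite iterS IH (linear_sum (L0N lam a)).
under eq_bigr => i _ do rewrite (linearZ_LR (L0N lam a)) /= L0N_shift -!iterS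
  scalerDr !scalerA.
pose g i := 'C(j, i)%:R * (lam - a) ^+ (j.+1 - i) * 2^-1 ^+ i
             *: iter (j.+1 + i) shift w.
rewrite big_split /= [RHS]big_ord_recl /=.
(* Pascal's rule splits each coefficient binom(j+1, i+1) of the right-hand
   side: the part binom(j, i) comes from N^2 / 2, the part binom(j, i+1) from
   c N, whose missing last term is zero. *)
under [X in _ = _ + X]eq_bigr => i _ do
  rewrite /bump /= add1n binS natrD !mulrDl scalerDl.
rewrite big_split /= addrA; congr (_ + _); last first.
  apply: eq_bigr => i _; rewrite addnS; congr (_ *: _).
  by rewrite subSS exprSr mulrA.
transitivity (\sum_(i < j.+1) g i).
  apply: eq_bigr => i _; rewrite /g addSn; congr (_ *: _).
  by rewrite subSn -1?ltnS // exprSr; ring.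
have -> : \sum_(i < j.+1) g i = \sum_(i < j.+2) g i.
  by rewrite [RHS]big_ord_recr /= /g bin_small // !mul0r scale0r addr0.
by rewrite big_ord_recl /g /= !bin0.
Qed.

(** Of all the powers of N only the k-th reaches the first Jordan vector
    from the last one, as the Jordan block has size k + 1. *)
Lemma coeff_iter_L0N j (p : intpart) :
  coeff (p, ord0 : 'I_k.+1) (iter j (L0N lam a) (ket R (p, ord_max))) =
  if (j <= k)%N then
    'C(j, k - j)%:R * (lam - a) ^+ (j - (k - j)) * 2^-1 ^+ (k - j)
  else 0.
Proof.
rewrite iter_L0N raddf_sum /=.
have co m : coeff (p, ord0 : 'I_k.+1) (iter m shift (ket R (p, ord_max))) = (m == k)%:R.
  rewrite iter_shift_ket /=; case: ltngtP => mk; rewrite ?coeff0 //.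
    rewrite coeffU mul1r; case: eqP => // -[] /(congr1 val) /=.
    by rewrite inordK; lia.
  rewrite mk subnn coeffU mul1r; case: eqP => // -[].
  by congr pair; apply: val_inj; rewrite /= inordK.
under eq_bigr => i _ do rewrite coeffZ co.
case: leqP => jk; last first.
  apply: big1 => i _; rewrite (_ : (_ == k) = false) ?mulr0 //.
  by apply/eqP; lia.
case: (leqP (k - j) j) => kj; last first.
  rewrite [in RHS]bin_small // !mul0r; apply: big1 => i _.
  by rewrite (_ : (_ == k) = false) ?mulr0 //; apply/eqP; have := ltn_ord i; lia.
have kj' : (k - j < j.+1)%N by [].
rewrite (bigD1 (Ordinal kj')) //= subnKC // eqxx mulr1 big1 ?addr0 // => i ne.
rewrite (_ : (_ == k) = false) ?mulr0 //; apply/eqP => e.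
by case/eqP: ne; apply: val_inj => /=; lia.
Qed.

End ShiftPowers.

(** All npart l diagonal entries of the corner block are equal, since L_0^N does
    not see the monomial. *)
Lemma graded_pstr_summand_vacuum (R : realType) (a lam : R[i]) k tau l j :
  graded_pstr_summand a lam k.+2 (vacuum R) tau l j =
  if (j <= k.+1)%N then
    (npart l)%:R * (j`!%:R^-1 * 'C(j, k.+1 - j)%:R * 2^-1 ^+ (k.+1 - j)
    * (lam - a) ^+ (j - (k.+1 - j)) * logq tau ^+ j)
  else 0.
Proof.
rewrite /graded_pstr_summand /pstr /block /mxtrace.
under eq_bigr => i _.
  rewrite mxE zero_mode_vacuum coeffZ coeff_iter_L0N.
over.
rewrite sumr_const card_ord -/(npart l).
case: ifP => _; last by rewrite mulr0 mul0rn mul0r.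
by rewrite -[X in X * _]mulr_natl; ring.
Qed.

(** * Convergence of complex sequences *)

Section ComplexLimits.
Variable R : realType.
Implicit Types (u : nat -> R[i]) (f : nat -> R[i]) (g : nat -> R).

Lemma norm_real_complex (x : R) : `|x%:C| = `|x|%:C.
Proof. by rewrite normc_def /= expr0n /= addr0 sqrtr_sqr. Qed.

Lemma cvg_real_complex g (l : R) :
  g n @[n --> \oo] --> l -> (g n)%:C @[n --> \oo] --> l%:C.
Proof.
move=> /cvgrPdist_lt gl; apply/cvgrPdist_lt => e e0.
(* The radius e is a positive complex number, hence real. *)
have er : e = (complex.Re e)%:C by apply/esym/RRe_real; exact: gtr0_real.
have {}e0 : 0 < complex.Re e by rewrite -ltcR -er.
apply: filterS (gl _ e0) => n.
by rewrite er -raddfB /= norm_real_complex ltcR.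
Qed.

Lemma cvgn_complex u :
  cvgn (fun n => complex.Re (u n)) -> cvgn (fun n => complex.Im (u n)) -> cvgn u.
Proof.
move=> /cvg_real_complex uRe /cvg_real_complex uIm.
have -> : u = fun n => (complex.Re (u n))%:C + 'i%C * (complex.Im (u n))%:C.
  by apply/funext => n; exact: complexE.
apply: is_cvgD; first by apply/cvg_ex; eexists; exact: uRe.
by apply/cvg_ex; eexists; apply: cvgMl_tmp; exact: uIm.
Qed.

Lemma norm_Im_le (z : R[i]) : `|complex.Im z|%:C <= `|z|.
Proof.
rewrite normc_def lecR -sqrtr_sqr ler_wsqrtr //.
by rewrite lerDr sqr_ge0.
Qed.

(** Adding T makes v nondecreasing and bounded. *)
Lemma cvgn_real_increments (v T : nat -> R) : cvgn T ->
  (forall n, `|v n.+1 - v n| <= T n.+1 - T n) -> cvgn v.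
Proof.
move=> cT vT.
have nT : nondecreasing_seq T.
  by apply/nondecreasing_seqP => n; rewrite -subr_ge0 (le_trans _ (vT n)).
have nv : nondecreasing_seq (T + v).
  apply/nondecreasing_seqP => n; have := vT n; rewrite ler_norml !fctE => /andP[? ?].
  by lra.
have -> : v = (T + v) - T by rewrite addrAC subrr add0r.
apply: is_cvgB => //; apply: nondecreasing_is_cvgn => //.
exists (limn T *+ 2 - T 0%N + v 0%N) => _ [n _ <-].
have vn : v n <= T n - T 0%N + v 0%N.
  elim: n => [|n IH]; first by rewrite subrr add0r.
  by have := vT n; rewrite ler_norml => /andP[? ?]; lra.
have := nondecreasing_cvgn_le nT cT n; rewrite !fctE; lra.
Qed.

(** The comparison test, obtained from the real and imaginary parts. *)
Lemma cvgn_series_dominated f g : cvgn (series g) ->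
  (forall n, `|f n| <= (g n)%:C) -> cvgn (series f).
Proof.
move=> cg fg; apply: cvgn_complex; apply: cvgn_real_increments cg _ => n;
  rewrite -raddfB /= !seriesEnat /= !big_nat_recr //= [X in `|_ X|]addrAC subrr
    add0r addrAC subrr add0r -lecR.
  exact: le_trans (normc_ge_Re _) (fg n).
exact: le_trans (norm_Im_le _) (fg n).
Qed.
End ComplexLimits.

(** * The exponential q^s *)

Section ComplexExponential.
Variable R : realType.
Implicit Types (z w tau : R[i]).

Lemma cexpD z w : cexp (z + w) = cexp z * cexp w.
Proof.
case: z w => [x y] [x' y']; rewrite /cexp /= expRD cosD sinD.
by apply/eqP; rewrite eq_complex /=; apply/andP; split; apply/eqP; ring.
Qed.

Lemma cexp0 : cexp (0 : R[i]) = 1.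
Proof. by rewrite /cexp /= expR0 cos0 sin0 mul1r. Qed.

Lemma norm_cexp z : `|cexp z| = (expR (complex.Re z))%:C.
Proof.
rewrite normrM norm_real_complex (ger0_norm (expR_ge0 _)).
by rewrite normc_def /= cos2Dsin2 sqrtr1 mulr1.
Qed.

Lemma cexp_neq0 z : cexp z != 0.
Proof. by rewrite -normr_gt0 norm_cexp ltcR expR_gt0. Qed.

Lemma qpowD tau s t : qpow tau (s + t) = qpow tau s * qpow tau t.
Proof. by rewrite /qpow mulrDl cexpD. Qed.

Lemma qpow_nat tau n : qpow tau n%:R = qpow tau 1 ^+ n.
Proof.
elim: n => [|n IH]; first by rewrite /qpow mul0r cexp0.
by rewrite -addn1 natrD qpowD IH exprD expr1.
Qed.

Lemma norm_qpow1_lt1 tau : 0 < complex.Im tau ->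
  exists2 r : R, 0 <= r < 1 & `|qpow tau 1| = r%:C.
Proof.
move=> tau0; exists (expR (complex.Re (logq tau))); last first.
  by rewrite /qpow mul1r norm_cexp.
rewrite expR_ge0 /= -expR0 ltr_expR /logq.
case: tau tau0 => x y /= y0.
have := pi_gt0 R; nra.
Qed.
End ComplexExponential.

(** * Partitions with bounded parts *)

Section RestrictedPartitions.

(** Bounding the parts truncates Euler's product to its factors of index less
    than N. *)
Definition npart_lt N l :=
  count (fun p : intpart => all (ltn^~ N) p) (partitions_of l).

Lemma part_le_sumn x (s : seq nat) : x \in s -> (x <= sumn s)%N.
Proof.
elim: s => //= y s IH; rewrite in_cons => /orP[/eqP->|/IH xs].
  by rewrite leq_addr.
exact: leq_trans xs (leq_addl _ _).
Qed.

Lemma npart_lt_le N l : (npart_lt N l <= npart l)%N.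
Proof. exact: count_size. Qed.

Lemma npart_lt_npart N l : (l < N)%N -> npart_lt N l = npart l.
Proof.
move=> lN; apply/eqP; rewrite -all_count; apply/allP => p.
rewrite mem_partitions_of => /eqP pl; apply/allP => x /part_le_sumn xp /=.
by rewrite (leq_ltn_trans xp) // pl.
Qed.

Lemma npart_lt1 l : npart_lt 1 l = (l == 0%N).
Proof.
have -> : npart_lt 1 l = count (pred1 empty_part) (partitions_of l).
  apply: eq_count => p /=; apply/allP/eqP => [p1|-> //].
  apply: val_inj => /=; have /andP[_] := partsP p.
  by case: (val p) p1 => // x s /(_ x (mem_head _ _)) /=; case: x.
by rewrite count_uniq_mem ?partitions_of_uniq // mem_partitions_of eq_sym.
Qed.

(** A partition with parts at most N + 1 either has no part N + 1 or arises by
    adding a part N + 1 to a unique such partition of l - (N + 1). *)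
Lemma npart_ltS N l : npart_lt N.+2 l =
  (npart_lt N.+1 l + if (N < l)%N then npart_lt N.+2 (l - N.+1) else 0)%N.
Proof.
have [all_add sum_add] :
    (forall (p : intpart) (a : pred nat), all a (add_part N p) = a N.+1 && all a p)
    /\ (forall p : intpart, sumn (add_part N p) = (N.+1 + sumn p)%N).
  split=> [p a|p]; first by rewrite /= all_sort.
  by rewrite /= (perm_sumn (permEl (perm_sort _ _))).
have remK (p : intpart) : N.+1 \in val p -> add_part N (rem_part N.+1 p) = p.
  move=> Np; apply: intpart_eqP => x; rewrite count_add_part count_rem_part.
  by rewrite subnKC //; case: eqP => // <-; rewrite -has_count has_pred1.
have addK : injective (add_part N).
  move=> p p' e; apply: intpart_eqP => x; apply: (@addnI (N.+1 == x)).
  by rewrite -!count_add_part e.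
rewrite {1}/npart_lt -size_filter.
rewrite -(count_predC (fun p : intpart => N.+1 \in val p)) addnC.
rewrite !(count_filter _ _ (partitions_of l)).
congr (_ + _)%N.
  apply: eq_count => p /=; apply/andP/allP => [[Np /allP pN x xp]|pN].
    have := pN x xp; rewrite /= ltnS leq_eqVlt => /orP[/eqP xN|//].
    by move: xp Np; rewrite xN => ->.
  split; first by apply/negP => /pN /=; rewrite ltnn.
  by apply/allP => x /pN /= /ltnW.
rewrite -size_filter; case: (ltnP N l) => Nl; last first.
  apply/eqP; rewrite size_eq0 -[_ == _]negbK -has_filter.
  apply/hasPn => p; rewrite mem_partitions_of => /eqP pl /=.
  by apply/nandP; left; apply/negP => /part_le_sumn; rewrite pl; lia.
rewrite /npart_lt -size_filter -[RHS](size_map (add_part N)); apply/perm_size/uniq_perm.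
- by rewrite filter_uniq // partitions_of_uniq.
- by rewrite map_inj_uniq // filter_uniq // partitions_of_uniq.
move=> p; rewrite mem_filter mem_partitions_of /=; apply/idP/mapP.
  case/andP => /andP[/remK Np pN] pl; exists (rem_part N.+1 p); last by rewrite Np.
  move: pN pl; rewrite -{1 2}Np all_add sum_add mem_filter mem_partitions_of.
  by case/andP => _ -> /eqP <- /=; rewrite addKn eqxx.
case=> p'; rewrite mem_filter mem_partitions_of => /andP[pN pl] ->.
rewrite all_add sum_add pN ltnSn mem_sort mem_head /=.
by apply/eqP; move/eqP: pl; lia.
Qed.

End RestrictedPartitions.

(** * Euler's partition identity *)

Section PartitionSeries.

(** The recurrence on generating functions: F_(N+2) = F_(N+1) + x^(N+1) F_(N+2),
    for sums truncated at degree L. *)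
Lemma sum_npart_ltS (A : comNzRingType) (x : A) N L :
  \sum_(0 <= l < L) (npart_lt N.+2 l)%:R * x ^+ l =
  \sum_(0 <= l < L) (npart_lt N.+1 l)%:R * x ^+ l
  + x ^+ N.+1 * \sum_(0 <= l < L - N.+1) (npart_lt N.+2 l)%:R * x ^+ l.
Proof.
under eq_bigr => l _ do rewrite npart_ltS natrD mulrDl.
rewrite big_split /=; congr (_ + _).
have [LN|NL] := leqP L N.+1.
  have -> : (L - N.+1 = 0)%N by lia.
  rewrite [in RHS]big_geq // mulr0 big_nat big1 // => l /= lL.
  by rewrite ifF ?mul0r //; lia.
rewrite (@big_cat_nat _ _ _ N.+1) //=; last exact: ltnW.
rewrite big_nat big1 ?add0r; last by move=> l /= lN; rewrite ifF ?mul0r //; lia.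
rewrite -{1}[N.+1]add0n big_addn big_distrr /=; apply: eq_bigr => l _.
by rewrite addnK ifT ?exprD; [ring|lia].
Qed.

Variable R : realType.

(** Write (1 - r^j)^(-1) as 1 + r^j / (1 - r^j), and use r^j <= r. *)
Lemma inv_1subX_le_expR (r : R) j : 0 <= r < 1 ->
  (1 - r ^+ j.+1)^-1 <= expR (r ^+ j.+1 / (1 - r)).
Proof.
move=> /andP[r0 r1].
have rj0 : 0 <= r ^+ j.+1 by rewrite exprn_ge0.
have rj : r ^+ j.+1 <= r by rewrite exprS ler_piMr // exprn_ile1 // ltW.
have [u0 v0] : 1 - r ^+ j.+1 != 0 /\ 1 - r != 0 by split; lra.
apply: le_trans (expR_ge1Dx _).
rewrite (_ : _^-1 = 1 + r ^+ j.+1 / (1 - r ^+ j.+1)); last by field.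
rewrite lerD2l ler_wpM2l // lef_pV2 ?posrE; lra.
Qed.

Lemma sum_expr_le (r : R) n : 0 <= r < 1 ->
  \sum_(i < n) r ^+ i.+1 <= (1 - r)^-1.
Proof.
move=> /andP[r0 r1].
have H : (1 - r) * \sum_(i < n) r ^+ i.+1 = r - r ^+ n.+1.
  elim: n => [|n IH]; first by rewrite big_ord0 expr1; ring.
  by rewrite big_ord_recr /= mulrDr IH !exprS; ring.
rewrite -[leRHS]mul1r ler_pdivlMr ?subr_gt0 // mulrC H.
have : 0 <= r ^+ n.+1 by rewrite exprn_ge0.
lra.
Qed.

(** The truncated sums are at most prod_(1 <= j <= N) (1 - r^j)^(-1), each factor
    of which is at most exp(r^j / (1 - r)).  The bound must not depend on N, as
    the sums over all partitions are recovered by taking N as large as L. *)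
Lemma sum_npart_lt_bounded (r : R) N L : 0 <= r < 1 ->
  \sum_(0 <= l < L) (npart_lt N.+1 l)%:R * r ^+ l <= expR ((1 - r)^-1 / (1 - r)).
Proof.
move=> r01; have /andP[r0 r1] := r01.
apply: (@le_trans _ _ (expR ((\sum_(i < N) r ^+ i.+1) / (1 - r)))); last first.
  rewrite ler_expR ler_wpM2r ?sum_expr_le // invr_ge0; lra.
elim: N L => [|N IH] L.
  rewrite big_ord0 mul0r expR0; case: L => [|L]; first by rewrite big_geq.
  rewrite big_nat_recl // npart_lt1 mulr1 big1 ?addr0 // => l _.
  by rewrite npart_lt1 mul0r.
have rN0 : 0 <= r ^+ N.+1 by rewrite exprn_ge0.
have rN1 : r ^+ N.+1 < 1 by rewrite exprn_ilt1.
rewrite big_ord_recr /= mulrDl expRD.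
have := sum_npart_ltS r N L.
set F := \sum_(0 <= l < L) _; set G := \sum_(0 <= l < _ - _) _.
move=> FE; have GF : G <= F.
  rewrite /G /F [leRHS](@big_cat_nat _ _ _ (L - N.+1)) ?leq_subr //= lerDl.
  by apply: sumr_ge0 => l _; rewrite mulr_ge0 // exprn_ge0.
have {}FE : F * (1 - r ^+ N.+1) <= expR ((\sum_(i < N) r ^+ i.+1) / (1 - r)).
  by apply: le_trans (IH L); rewrite mulrBr mulr1; nra.
have : F <= expR ((\sum_(i < N) r ^+ i.+1) / (1 - r)) * (1 - r ^+ N.+1)^-1.
  by rewrite ler_pdivlMr // subr_gt0.
move/le_trans; apply; rewrite ler_wpM2l ?expR_ge0 //.
exact: inv_1subX_le_expR.
Qed.

Lemma cvgn_series_npart_real (r : R) : 0 <= r < 1 ->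
  cvgn (series (fun l => (npart l)%:R * r ^+ l)).
Proof.
move=> r01; have /andP[r0 r1] := r01.
apply: nondecreasing_is_cvgn.
  apply/nondecreasing_seqP => n; rewrite !seriesEnat /= big_nat_recr //= lerDl.
  by rewrite mulr_ge0 // exprn_ge0.
exists (expR ((1 - r)^-1 / (1 - r))) => _ [n _ <-].
apply: le_trans (sum_npart_lt_bounded n n r01).
rewrite seriesEnat /= le_eqVlt; apply/orP; left; apply/eqP.
rewrite !big_nat; apply: eq_bigr => l /andP[_ ln].
by rewrite npart_lt_npart // ltnS ltnW.
Qed.

Variables (q : R[i]) (r : R).
Hypotheses (r01 : 0 <= r < 1) (qr : `|q| = r%:C).

Let euler N := \prod_(1 <= j < N) (1 - q ^+ j).

Lemma norm_nat_mulX (n m l : nat) : (n <= m)%N ->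
  `|n%:R * q ^+ l| <= (m%:R * r ^+ l)%:C.
Proof.
move=> nm; rewrite normrM normr_nat normrX qr -rmorphXn /=.
rewrite rmorphM /= rmorph_nat ler_wpM2r ?ler_nat //.
by rewrite -[0]/(0%:C) lecR exprn_ge0 //; case/andP: r01.
Qed.

Lemma cvgn_series_npart_lt N :
  cvgn (series (fun l => (npart_lt N l)%:R * q ^+ l)).
Proof.
apply: cvgn_series_dominated (cvgn_series_npart_real r01) _ => l.
exact/norm_nat_mulX/npart_lt_le.
Qed.

Lemma cvgn_series_npart : cvgn (series (fun l => (npart l)%:R * q ^+ l)).
Proof.
apply: cvgn_series_dominated (cvgn_series_npart_real r01) _ => l.
exact: norm_nat_mulX.
Qed.

Lemma euler_factor_neq0 j : 1 - q ^+ j.+1 != 0.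
Proof.
rewrite subr_eq0; apply/eqP => /(congr1 Num.norm).
rewrite normr1 normrX qr -rmorphXn /= => /(congr1 (@complex.Re R)) /= e.
have /andP[r0 r1] := r01.
have : r ^+ j.+1 < 1 by rewrite exprn_ilt1.
by rewrite -e ltxx.
Qed.

Lemma euler_neq0 N : euler N != 0.
Proof.
rewrite /euler big_nat prodf_seq_neq0; apply/allP => -[|j] _ //=.
by rewrite euler_factor_neq0 implybT.
Qed.

Lemma eulerS N : euler N.+2 = euler N.+1 * (1 - q ^+ N.+1).
Proof. by rewrite /euler big_nat_recr. Qed.

(** The limit G exists by comparison, and letting L tend to infinity in the
    recurrence gives G = 1 / euler (N + 1) + q^(N+1) G. *)
Lemma cvg_series_npart_lt N :
  series (fun l => (npart_lt N.+1 l)%:R * q ^+ l) n @[n --> \oo] --> (euler N.+1)^-1.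
Proof.
elim: N => [|N IH].
  rewrite /euler big_geq // invr1; apply: cvg_near_cst.
  exists 1%N => // -[//|n] _; rewrite seriesEnat /= big_nat_recl //.
  rewrite npart_lt1 mulr1 big1 ?addr0 // => l _.
  by rewrite npart_lt1 mul0r.
have /cvg_ex[G cG] := @cvgn_series_npart_lt N.+2.
suff <- : G = (euler N.+2)^-1 by [].
have cG' := cG; rewrite -(cvg_shiftn N.+1) in cG'.
have cGr : series (fun l => (npart_lt N.+2 l)%:R * q ^+ l) (n + N.+1)%N @[n --> \oo]
    --> (euler N.+1)^-1 + q ^+ N.+1 * G.
  rewrite -(cvg_shiftn N.+1) in IH.
  apply: cvg_trans (cvgD IH (cvgMl_tmp (a := q ^+ N.+1) cG)).
  apply: near_eq_cvg; apply: nearW => n /=.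
  by rewrite !seriesEnat /= sum_npart_ltS addnK.
have GE : G = (euler N.+1)^-1 + q ^+ N.+1 * G.
  exact: (cvg_unique _ cG' cGr).
have {}GE : G * (1 - q ^+ N.+1) = (euler N.+1)^-1.
  by rewrite mulrBr mulr1 {1}GE; ring.
by rewrite eulerS invfM -GE mulfK // euler_factor_neq0.
Qed.

(** Each factor satisfies |1 - q^j| <= 1 + r^j <= exp(r^j).  The bound keeps
    1 / euler away from zero. *)
Lemma norm_euler_le N : `|euler N| <= (expR (1 - r)^-1)%:C.
Proof.
have /andP[r0 r1] := r01.
case: N => [|N].
  rewrite /euler big_geq // normr1 -[1]/(1%:C) lecR -[leLHS]expR0.
  by rewrite ler_expR invr_ge0 subr_ge0 ltW.
apply: (@le_trans _ _ (expR (\sum_(i < N) r ^+ i.+1))%:C); last first.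
  by rewrite lecR ler_expR sum_expr_le.
elim: N => [|N IH]; first by rewrite /euler big_geq // big_ord0 expR0 normr1.
rewrite eulerS normrM big_ord_recr /= expRD rmorphM ler_pM //=.
apply: le_trans (ler_normB _ _) _.
rewrite normr1 normrX qr -rmorphXn -[1]/(1%:C) -rmorphD /= lecR.
exact: expR_ge1Dx.
Qed.

(** Euler's identity.  It is 1 / euler that is shown to converge first, to the sum
    S of the series; the convergence of euler itself then follows from S != 0. *)
Lemma partition_generating_function :
  exists2 S : R[i], S != 0 &
    series (fun l => (npart l)%:R * q ^+ l) n @[n --> \oo] --> S /\
    euler n @[n --> \oo] --> S^-1.
Proof.
have /cvg_ex[S cS] := cvgn_series_npart.
have cT := cvgn_series_npart_real r01.
have nT : nondecreasing_seq (series (fun l => (npart l)%:R * r ^+ l)).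
  apply/nondecreasing_seqP => n; rewrite !seriesEnat /= big_nat_recr //= lerDl.
  by rewrite mulr_ge0 // exprn_ge0; case/andP: r01.
have cE : (euler N.+1)^-1 @[N --> \oo] --> S.
  apply/cvgrPdist_lt => e e0.
  have e3 : 0 < e / 3 by rewrite divr_gt0.
  have er : e / 3 = (complex.Re (e / 3))%:C by apply/esym/RRe_real; exact: gtr0_real.
  have {}er0 : 0 < complex.Re (e / 3) by rewrite -ltcR -er.
  have /cvgrPdist_lt/(_ _ er0) := cT; apply: filterS => N TN.
  have /cvgrPdist_lt/(_ _ e3) [L1 _ HL1] := @cvg_series_npart_lt N.
  have /cvgrPdist_lt/(_ _ e3) [L2 _ HL2] := cS.
  (* L is large enough for both series to be close to their sums at L, and
     at least N, below which the coefficients of the two series agree. *)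
  pose L := (L1 + L2 + N)%N.
  have := HL1 L; rewrite /= => /(_ ltac:(rewrite /L; lia)) d1.
  have := HL2 L; rewrite /= => /(_ ltac:(rewrite /L; lia)) d2.
  set F := series (fun l => (npart_lt N.+1 l)%:R * q ^+ l) L in d1.
  set P := series (fun l => (npart l)%:R * q ^+ l) L in d2.
  have d3 : `|P - F| < e / 3.
    apply: (@le_lt_trans _ _ (series (fun l => (npart l)%:R * r ^+ l) L
                  - series (fun l => (npart l)%:R * r ^+ l) N)%:C); last first.
      rewrite er ltcR; apply: le_lt_trans TN.
      have := nondecreasing_cvgn_le nT cT L; rewrite ger0_norm; first by lra.
      by rewrite subr_ge0 nondecreasing_cvgn_le.
    have NL : (N <= L)%N by rewrite /L; lia.
    rewrite /P /F !seriesEnat /= -sumrB !(@big_cat_nat _ _ _ N 0 L) //=.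
    rewrite big_nat big1 ?add0r; last first.
      by move=> l /= lN; rewrite npart_lt_npart ?subrr //; lia.
    rewrite addrAC subrr add0r raddf_sum; apply: le_trans (ler_norm_sum _ _ _) _.
    apply: ler_sum => l _; rewrite -mulrBl -natrB ?npart_lt_le //.
    exact/norm_nat_mulX/leq_subr.
  have -> : S - (euler N.+1)^-1 = (S - P) + (P - F) - ((euler N.+1)^-1 - F) by ring.
  have -> : e = e / 3 + e / 3 + e / 3 by field.
  apply: le_lt_trans (ler_normB _ _) _; rewrite ltrD //.
  by apply: le_lt_trans (ler_normD _ _) _; rewrite ltrD.
have S0 : S != 0.
  apply/eqP => S0; rewrite S0 in cE.
  have c0 : 0 < ((expR (1 - r)^-1)^-1)%:C by rewrite ltcR invr_gt0 expR_gt0.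
  have /cvgrPdist_lt/(_ _ c0) [N _ /(_ N (leqnn N))] := cE.
  rewrite /= sub0r normrN normfV fmorphV /= ltf_pV2 ?posrE ?normr_gt0 ?euler_neq0 //.
    by move=> /lt_le_trans /(_ (norm_euler_le _)); rewrite ltxx.
  by rewrite ltcR expR_gt0.
exists S; [exact: S0|split; [exact: cS|]].
rewrite -(cvg_shiftn 1 euler); apply: cvg_trans (cvgV S0 cE).
apply: near_eq_cvg; apply: nearW => n /=.
by rewrite invrK addn1.
Qed.

End PartitionSeries.

(** * The graded pseudo-trace of the vacuum *)

Section GradedPseudoTrace.
Variable R : realType.

(** With c = lam - a and x = log q, this is the polynomial in log q that the
    theorem asserts. *)
Definition pstr_poly (k : nat) (c x : R[i]) : R[i] :=
  \sum_(uphalf k.-1 <= j < k)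
    (j`!%:R)^-1 * 'C(j, k - j - 1)%:R * 2 ^ (- k%:Z + j%:Z + 1)
    * c ^ (2 * j%:Z - k%:Z + 1) * x ^+ j.

(** The natural exponents are those of the expansion of (c N + N^2 / 2)^j.  The
    terms of index below k / 2 have a zero binomial, and beyond it no subtraction
    is truncated, so the integer exponents agree with them. *)
Lemma pstr_polyE k (c x : R[i]) :
  pstr_poly k.+1 c x = \sum_(0 <= j < k.+1)
    (j`!%:R^-1 * 'C(j, k - j)%:R * 2^-1 ^+ (k - j) * c ^+ (j - (k - j)) * x ^+ j).
Proof.
rewrite /pstr_poly [RHS](@big_cat_nat _ _ _ (uphalf k)) //=; last by lia.
rewrite [X in _ = X + _]big_nat [X in _ = X + _]big1 ?add0r; last first.
  by move=> j /= jk; rewrite bin_small ?(mulr0, mul0r) //; lia.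
apply: eq_big_nat => j /andP[jk kj]; congr (_ * _ * _ * _ * _).
- by congr ('C(_, _)%:R); lia.
- by rewrite exprVn (_ : _ + 1 = - (k - j)%N%:Z); [rewrite -exprnN|lia].
- by rewrite (_ : _ + 1 = (j - (k - j))%N%:Z); [|lia].
Qed.

Lemma cvg_series_finite (f : nat -> R[i]) K : (forall n, (K <= n)%N -> f n = 0) ->
  series f n @[n --> \oo] --> \sum_(0 <= n < K) f n.
Proof.
move=> f0; apply: cvg_near_cst; exists K => // n /= Kn.
rewrite seriesEnat /= (@big_cat_nat _ _ _ K) //= [X in _ + X]big_nat.
by rewrite [X in _ + X]big1 ?addr0 // => i /andP[/f0].
Qed.

Variables (a lam tau : R[i]) (k : nat).
Hypothesis k_ge2 : (2 <= k)%N.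

Lemma cvg_graded_pstr_summand l :
  series (graded_pstr_summand a lam k (vacuum R) tau l) n @[n --> \oo] -->
  (npart l)%:R * pstr_poly k (lam - a) (logq tau).
Proof.
case: k k_ge2 => [|[|k']] // _; rewrite pstr_polyE big_distrr /=.
have -> : \sum_(0 <= j < k'.+2) (npart l)%:R * (j`!%:R^-1 * 'C(j, k'.+1 - j)%:R
     * 2^-1 ^+ (k'.+1 - j) * (lam - a) ^+ (j - (k'.+1 - j)) * logq tau ^+ j)
   = \sum_(0 <= j < k'.+2) graded_pstr_summand a lam k'.+2 (vacuum R) tau l j.
  by apply: eq_big_nat => j /andP[_ jk]; rewrite graded_pstr_summand_vacuum -ltnS jk.
apply: cvg_series_finite => n kn.
by rewrite graded_pstr_summand_vacuum ifF //; lia.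
Qed.

Lemma graded_pstr_termE l : graded_pstr_term a lam k (vacuum R) tau l =
  qpow tau (2^-1 * (lam - a) ^+ 2 - 24^-1)
  * (qpow tau 1 ^+ l * (npart l)%:R * pstr_poly k (lam - a) (logq tau)).
Proof.
rewrite /graded_pstr_term /graded_pstr_coef.
have -> : limn (series (graded_pstr_summand a lam k (vacuum R) tau l)) =
   (npart l)%:R * pstr_poly k (lam - a) (logq tau).
  by apply: cvg_lim; [exact: norm_hausdorff|exact: cvg_graded_pstr_summand].
have -> : weight lam a l - central_charge a / 24
    = (2^-1 * (lam - a) ^+ 2 - 24^-1) + l%:R.
  by rewrite /weight /central_charge; field.
by rewrite qpowD qpow_nat; ring.
Qed.

End GradedPseudoTrace.

Theorem theorem4p6 (R : realType) (a lam : R[i]) (k : nat) (k_ge2 : (2 <= k)%N)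
    (tau : R[i]) (tau_upper : 0 < complex.Im tau) :
  let q := qpow tau 1 in
  let P : R[i] :=
    \sum_(uphalf k.-1 <= j < k)
      (j`!%:R)^-1 * 'C(j, k - j - 1)%:R * 2 ^ (- k%:Z + j%:Z + 1)
      * (lam - a) ^ (2 * j%:Z - k%:Z + 1) * logq tau ^+ j in
  [/\ forall l, cvgn (series (graded_pstr_summand a lam k (vacuum R) tau l)),
      cvgn (series (graded_pstr_term a lam k (vacuum R) tau)),
      cvgn (series (fun l => q ^+ l * (npart l)%:R * P)),
      cvgn (fun N => \prod_(1 <= j < N) (1 - q ^+ j)) /\ dedekind_eta tau != 0 &
      graded_pstr a lam k (vacuum R) tau
      = qpow tau (2^-1 * (lam - a) ^+ 2 - 24^-1)
        * limn (series (fun l => q ^+ l * (npart l)%:R * P))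
      /\
      graded_pstr a lam k (vacuum R) tau
      = qpow tau (2^-1 * (lam - a) ^+ 2) * (dedekind_eta tau)^-1 * P].
Proof.
move=> q P.
have [r r01 qr] := norm_qpow1_lt1 tau_upper.
have [S S0 [cS cE]] := partition_generating_function r01 qr.
have cSP : series (fun l => q ^+ l * (npart l)%:R * P) n @[n --> \oo] --> S * P.
  apply: cvg_trans (cvgM cS (cvg_cst P)); apply: near_eq_cvg; apply: nearW => n.
  rewrite /= !seriesEnat /= big_distrl /=; apply: eq_bigr => l _.
  by rewrite [_ * q ^+ l]mulrC.
set A := qpow tau (2^-1 * (lam - a) ^+ 2 - 24^-1).
have cT : series (graded_pstr_term a lam k (vacuum R) tau) n @[n --> \oo] --> A * (S * P).
  apply: cvg_trans (cvgMl_tmp (a := A) cSP).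
  apply: near_eq_cvg; apply: nearW => n.
  rewrite /= !seriesEnat /= big_distrr /=; apply: eq_bigr => l _.
  by rewrite (graded_pstr_termE a lam tau k_ge2 l).
have limE (u : nat -> R[i]) (l : R[i]) : u n @[n --> \oo] --> l -> limn u = l.
  by apply: cvg_lim; exact: norm_hausdorff.
have etaE : dedekind_eta tau = qpow tau 24^-1 * S^-1.
  by rewrite /dedekind_eta (limE _ _ cE).
have gE : graded_pstr a lam k (vacuum R) tau = A * (S * P) by exact: limE.
split.
- by move=> l; apply/cvg_ex; eexists; exact: cvg_graded_pstr_summand.
- by apply/cvg_ex; eexists; exact: cT.
- by apply/cvg_ex; eexists; exact: cSP.
- split; first by apply/cvg_ex; eexists; exact: cE.
  by rewrite etaE mulf_neq0 ?invr_eq0 // cexp_neq0.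
split; first by rewrite (limE _ _ cSP).
have q24 : qpow tau 24^-1 != 0 by exact: cexp_neq0.
rewrite gE etaE invfM invrK.
have -> : qpow tau (2^-1 * (lam - a) ^+ 2) = A * qpow tau 24^-1.
  by rewrite -qpowD subrK.
by field.
Qed.
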